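(* Let $(\mathcal{J},\bullet)$ be a mock-Lie superalgebra, $\mathcal{V}$ a $\mathbb{Z}_2$-graded vector space and $\pi:\mathcal{J}\to\mathrm{End}(\mathcal{V})$ an even linear map. Then the $\mathbb{Z}_2$-graded vector space $\overline{\mathcal{J}}=\mathcal{J}\oplus\mathcal{V}$ endowed with the product $$(x+u)\star(y+v)=x\bullet y+\pi(x)(v)+(-1)^{|x||y|}\pi(y)(u),\qquad (x+u,y+v)\in\overline{\mathcal{J}}_{|x|}\times\overline{\mathcal{J}}_{|y|},$$ is a mock-Lie superalgebra if and only if $(\mathcal{V},\pi)$ is a representation of $\mathcal{J}$.
   Context: All vector spaces are finite-dimensional over a field $\mathbb{K}$ of characteristic $0$; $|x|$ denotes the degree of a homogeneous element $x$ of a $\mathbb{Z}_2$-graded space. A mock-Lie superalgebra is a $\mathbb{Z}_2$-graded vector space $\mathcal{J}=\mathcal{J}_{\bar 0}\oplus\mathcal{J}_{\bar 1}$ with an even bilinear product $\bullet$ (i.e. $\mathcal{J}_i\bullet\mathcal{J}_j\subset\mathcal{J}_{i+j}$) such that for all homogeneous $x,y,z$: $x\bullet y=(-1)^{|x||y|}y\bullet x$, and $(-1)^{|x||z|}x\bullet(y\bullet z)+(-1)^{|x||y|}y\bullet(z\bullet x)+(-1)^{|y||z|}z\bullet(x\bullet y)=0$. $\mathrm{End}(\mathcal{V})$ carries its natural $\mathbb{Z}_2$-grading; $\pi$ even means $\pi(\mathcal{J}_i)\subset\mathrm{End}(\mathcal{V})_i$. A representation of $\mathcal{J}$ is a pair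 $(\mathcal{V},\pi)$ with $\mathcal V$ a $\mathbb{Z}_2$-graded vector space and $\pi:\mathcal{J}\to\mathrm{End}(\mathcal{V})$ an even linear map such that for all homogeneous $x,y\in\mathcal{J}$: $\pi(x\bullet y)=-\pi(x)\pi(y)-(-1)^{|x||y|}\pi(y)\pi(x)$. The grading on $\overline{\mathcal{J}}$ is $\overline{\mathcal{J}}_i=\mathcal{J}_i\oplus\mathcal{V}_i$, so for homogeneous $x+u$ both $x$ and $u$ have the same degree $|x|$; the product is extended bilinearly. *)

(* Defs.v *)
From mathcomp Require Export all_boot all_algebra.

Set Implicit Arguments.
Unset Strict Implicit.
Unset Printing Implicit Defensive.
Import GRing.Theory.
Local Open Scope ring_scope.

(* A Z_2-graded space is a finite-dimensional space A with a family of
   subspaces G : 'Z_2 -> {vspace A} of which A is the internal direct sum. *)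
Section Graded.
Variables (K : fieldType) (A : vectType K) (G : 'Z_2 -> {vspace A}).

Definition is_grading : Prop :=
  directv (\sum_(i : 'Z_2) G i) /\ (\sum_(i : 'Z_2) G i)%VS = fullv.

(* The component of degree i, meaningful when G is a grading. *)
Definition hcomp (i : 'Z_2) : A -> A := sumv_pi (\sum_(j : 'Z_2) G j)%VS i.

Definition End_degree (i : 'Z_2) (f : 'End(A)) : Prop :=
  forall j : 'Z_2, (f @: G j <= G (i + j)%R)%VS.

End Graded.

(* The exponent is a natural number: i and j are read as 0 or 1. *)
Definition ksign (K : fieldType) (i j : 'Z_2) : K := (-1) ^+ (i * j)%N.

Record is_mock_lie_superalgebra (K : fieldType) (J : vectType K)
    (G : 'Z_2 -> {vspace J}) (mul : J -> J -> J) : Prop :=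
  IsMockLieSuperalgebra {
    mock_grading : is_grading G;
    mock_linear_l : forall y : J, linear (mul^~ y);
    mock_linear_r : forall x : J, linear (mul x);
    mock_even : forall (i j : 'Z_2) (x y : J),
      x \in G i -> y \in G j -> mul x y \in G (i + j);
    mock_supercomm : forall (i j : 'Z_2) (x y : J),
      x \in G i -> y \in G j -> mul x y = ksign K i j *: mul y x;
    mock_jacobi : forall (i j k : 'Z_2) (x y z : J),
      x \in G i -> y \in G j -> z \in G k ->
      ksign K i k *: mul x (mul y z) + ksign K i j *: mul y (mul z x)
        + ksign K j k *: mul z (mul x y) = 0
  }.

Definition is_even_map (K : fieldType) (J V : vectType K)
    (GJ : 'Z_2 -> {vspace J}) (GV : 'Z_2 -> {vspace V})
    (pi : J -> 'End(V)) : Prop :=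
  forall (i : 'Z_2) (x : J), x \in GJ i -> End_degree GV i (pi x).

Record is_representation (K : fieldType) (J V : vectType K)
    (GJ : 'Z_2 -> {vspace J}) (mul : J -> J -> J)
    (GV : 'Z_2 -> {vspace V}) (pi : {linear J -> 'End(V)}) : Prop :=
  IsRepresentation {
    repr_grading : is_grading GV;
    repr_even : is_even_map GJ GV pi;
    repr_mul : forall (i j : 'Z_2) (x y : J),
      x \in GJ i -> y \in GJ j ->
      pi (mul x y) = - (pi x \o pi y)%VF - ksign K i j *: (pi y \o pi x)%VF
  }.

Section DirectSum.
Variables (K : fieldType) (J V : vectType K).
Variables (GJ : 'Z_2 -> {vspace J}) (GV : 'Z_2 -> {vspace V}).
Variables (mul : J -> J -> J) (pi : {linear J -> 'End(V)}).

Definition sum_grading (i : 'Z_2) : {vspace J * V} :=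
  (linfun (@fst J V) @^-1: GJ i :&: linfun (@snd J V) @^-1: GV i)%VS.

(* The formula (x + u) * (y + v) = x y + pi(x) v + (-1)^(|x||y|) pi(y) u, valid
   for arguments of degrees i and j. *)
Definition star_hom (i j : 'Z_2) (a b : J * V) : J * V :=
  (mul a.1 b.1, pi a.1 b.2 + ksign K i j *: pi b.1 a.2).

(* Its bilinear extension to the direct sum: see star_homE. *)
Definition star (a b : J * V) : J * V :=
  \sum_(i : 'Z_2) \sum_(j : 'Z_2)
    star_hom i j (hcomp sum_grading i a) (hcomp sum_grading j b).

Lemma mem_sum_grading i a :
  (a \in sum_grading i) = (a.1 \in GJ i) && (a.2 \in GV i).
Proof. by rewrite memv_cap -!memv_preim !lfunE. Qed.

End DirectSum.

Lemma hcomp_hom (K : fieldType) (A : vectType K) (G : 'Z_2 -> {vspace A})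
    (i j : 'Z_2) (x : A) :
  is_grading G -> x \in G i -> hcomp G j x = if j == i then x else 0.
Proof.
move=> [dG fG] xi.
pose d (k : 'Z_2) := hcomp G k x - (if k == i then x else 0).
have S0 : \sum_k d k = 0.
  rewrite big_split /= sumrN -big_mkcond big_pred1_eq.
  have -> : \sum_k hcomp G k x = x by apply: sumv_pi_sum; rewrite // fG memvf.
  by rewrite subrr.
apply/eqP; rewrite -subr_eq0; apply/eqP.
apply: (directv_sum_independent dG d _ S0) => // k _.
rewrite rpredB //; first exact: memv_sum_pi.
by case: eqP => [->|_] //; exact: mem0v.
Qed.

Lemma is_grading_sum (K : fieldType) (J V : vectType K)
    (GJ : 'Z_2 -> {vspace J}) (GV : 'Z_2 -> {vspace V}) :
  is_grading GJ -> is_grading GV -> is_grading (sum_grading GJ GV).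
Proof.
move=> [dJ fJ] [dV fV]; split.
  apply/directv_sum_independent => u Hu Su i _.
  have Hu1 k : ((u k).1 \in GJ k) /\ ((u k).2 \in GV k).
    by apply/andP; rewrite -mem_sum_grading Hu.
  have S1 : \sum_k (u k).1 = 0 by rewrite -(raddf_sum fst) Su.
  have S2 : \sum_k (u k).2 = 0 by rewrite -(raddf_sum snd) Su.
  rewrite [u i]surjective_pairing.
  have -> : (u i).1 = 0.
    by apply: (directv_sum_independent dJ _ _ S1) => // k _; case: (Hu1 k).
  suff -> : (u i).2 = 0 by [].
  by apply: (directv_sum_independent dV _ _ S2) => // k _; case: (Hu1 k).
apply/eqP; rewrite eqEsubv subvf; apply/subvP => -[x u] _.
have /memv_sumP[f Hf Ef] : x \in (\sum_i GJ i)%VS by rewrite fJ memvf.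
have /memv_sumP[g Hg Eg] : u \in (\sum_i GV i)%VS by rewrite fV memvf.
apply/memv_sumP; exists (fun i => (f i, g i)).
  by move=> i _; rewrite mem_sum_grading Hf ?Hg.
rewrite [RHS]surjective_pairing (raddf_sum fst) (raddf_sum snd) /=.
by rewrite -Ef -Eg.
Qed.

Lemma star_homE (K : fieldType) (J V : vectType K)
    (GJ : 'Z_2 -> {vspace J}) (GV : 'Z_2 -> {vspace V})
    (mul : J -> J -> J) (pi : {linear J -> 'End(V)}) (i j : 'Z_2)
    (x y : J) (u v : V) :
  is_mock_lie_superalgebra GJ mul -> is_grading GV ->
  x \in GJ i -> u \in GV i -> y \in GJ j -> v \in GV j ->
  star GJ GV mul pi (x, u) (y, v) =
    (mul x y, pi x v + ksign K i j *: pi y u).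
Proof.
move=> mJ gV xi ui yj vj.
have gS := is_grading_sum (mock_grading mJ) gV.
have ai : (x, u) \in sum_grading GJ GV i by rewrite mem_sum_grading xi.
have bj : (y, v) \in sum_grading GJ GV j by rewrite mem_sum_grading yj.
have mul0x z : mul 0 z = 0.
  by have := mock_linear_l mJ z (-1) 0 0; rewrite /= scaler0 addr0 scaleN1r addNr.
have mulx0 z : mul z 0 = 0.
  by have := mock_linear_r mJ z (-1) 0 0; rewrite /= scaler0 addr0 scaleN1r addNr.
rewrite /star (bigD1 i) //= (bigD1 j) //=.
rewrite !(hcomp_hom _ gS ai) !(hcomp_hom _ gS bj).
rewrite !eqxx big1 => [|k /negPf kj]; last first.
  by rewrite (hcomp_hom _ gS bj) kj
    /star_hom /= mulx0 !linear0 zero_lfunE ?scaler0 ?addr0 ?add0r.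
rewrite addr0 big1 ?addr0 // => k /negPf ki; rewrite big1 // => l _.
by rewrite (hcomp_hom _ gS ai) ki
  /star_hom /= mul0x !linear0 zero_lfunE ?scaler0 ?addr0 ?add0r.
Qed.

(* Main.v *)
(* For homogeneous x, y of degrees i, j let D(x, y) = pi(x y) + pi(x) pi(y)
   + (-1)^(i j) pi(y) pi(x) be the defect of pi at (x, y).  The V-component of
   the Jacobi sum of x + u, y + v, z + w, of degrees i, j, k, is
     (-1)^(i k) D(x, y) w + (-1)^(j k) D(z, x) v + (-1)^(i j) D(y, z) u,
   so it vanishes when pi is a representation; conversely, taking u = v = 0
   and z = 0 shows that D(x, y) kills every homogeneous w. *)
Require Import Defs.
Set Implicit Arguments.
Unset Strict Implicit.
Import GRing.Theory.
Local Open Scope ring_scope.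

Section KoszulSign.
Variable K : fieldType.
Implicit Types i j k : 'Z_2.

Lemma ksignC i j : ksign K i j = ksign K j i.
Proof. by rewrite /ksign mulnC. Qed.

Lemma ksignMK i j : ksign K i j * ksign K i j = 1.
Proof. by rewrite /ksign -exprD -signr_odd oddD addbb. Qed.

(** Addition in ['Z_2] reduces modulo 2, but only the parity of the exponent matters for a power of
    -1, and [odd_mod] says that the reduction keeps it. *)
Lemma ksignDr i j k : ksign K i (j + k) = ksign K i j * ksign K i k.
Proof.
by rewrite /ksign -exprD -mulnDr -signr_odd -[RHS]signr_odd !oddM /= odd_mod.
Qed.

End KoszulSign.

Lemma grading_decomp (K : fieldType) (A : vectType K) (G : 'Z_2 -> {vspace A})
    (x : A) : is_grading G -> x = \sum_i hcomp G i x.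
Proof. by move=> [_ fG]; rewrite sumv_pi_sum // fG memvf. Qed.

Lemma mem_hcomp (K : fieldType) (A : vectType K) (G : 'Z_2 -> {vspace A})
    (i : 'Z_2) (x : A) : hcomp G i x \in G i.
Proof. exact: memv_sum_pi. Qed.

(** The Jacobi identity speaks of homogeneous elements only; this carries an identity checked on
    them over to all vectors. *)
Lemma eq_lfun_homog (K : fieldType) (A B : vectType K) (G : 'Z_2 -> {vspace A})
    (f g : 'Hom(A, B)) :
  is_grading G -> (forall i x, x \in G i -> f x = g x) -> f = g.
Proof.
move=> gG fg; apply/lfunP => x; rewrite (grading_decomp x gG) !linear_sum.
by apply: eq_bigr => i _; apply: fg (mem_hcomp _ _ _).
Qed.

Lemma even_map_mem (K : fieldType) (J V : vectType K)
    (GJ : 'Z_2 -> {vspace J}) (GV : 'Z_2 -> {vspace V}) (pi : J -> 'End(V))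
    (i j : 'Z_2) (x : J) (v : V) :
  is_even_map GJ GV pi -> x \in GJ i -> v \in GV j -> pi x v \in GV (i + j).
Proof.
by move=> piE xi vj; apply: (subvP (piE i x xi j)); apply: memv_img.
Qed.

Section Star.
Variables (K : fieldType) (J V : vectType K).
Variables (GJ : 'Z_2 -> {vspace J}) (GV : 'Z_2 -> {vspace V}).
Variables (mul : J -> J -> J) (pi : {linear J -> 'End(V)}).
Hypotheses (mJ : is_mock_lie_superalgebra GJ mul) (gV : is_grading GV).
Hypothesis piE : is_even_map GJ GV pi.

Local Notation "a ** b" := (star GJ GV mul pi a b) (at level 40).
Local Notation GS := (sum_grading GJ GV).

(** The projections onto homogeneous components are linear, and the sign is constant within each
    summand of the double sum, so every summand is linear. *)
Lemma star_linear_l b : linear (fun a => a ** b).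
Proof.
move=> c a a' /=; rewrite /star scaler_sumr -big_split; apply: eq_bigr => i _ /=.
rewrite scaler_sumr -big_split; apply: eq_bigr => j _ /=.
rewrite /hcomp linearP /star_hom.
rewrite [RHS]surjective_pairing /= !linearP (mock_linear_l mJ) /=.
by congr pair; rewrite add_lfunE scale_lfunE !scalerDr addrACA !scalerA mulrC.
Qed.

Lemma star_linear_r a : linear (fun b => a ** b).
Proof.
move=> c b b' /=; rewrite /star scaler_sumr -big_split; apply: eq_bigr => i _ /=.
rewrite scaler_sumr -big_split; apply: eq_bigr => j _ /=.
rewrite /hcomp linearP /star_hom.
rewrite [RHS]surjective_pairing /= !linearP (mock_linear_r mJ) /=.
by congr pair; rewrite add_lfunE scale_lfunE !scalerDr addrACA !scalerA mulrC.
Qed.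

(** A form of [star_homE] for unsplit pairs, so that a product, homogeneous by [star_even], can
    itself be an argument. *)
Lemma starE i j a b : a \in GS i -> b \in GS j ->
  a ** b = (mul a.1 b.1, pi a.1 b.2 + ksign K i j *: pi b.1 a.2).
Proof.
case: a b => x u [y v]; rewrite !mem_sum_grading /=.
by move=> /andP[xi ui] /andP[yj vj]; apply: star_homE.
Qed.

Lemma star_even i j a b : a \in GS i -> b \in GS j -> a ** b \in GS (i + j).
Proof.
move=> ai bj; rewrite (starE ai bj); move: ai bj; rewrite !mem_sum_grading /=.
move=> /andP[xi ui] /andP[yj vj]; rewrite (mock_even mJ xi yj) /=.
rewrite rpredD ?rpredZ ?(even_map_mem piE xi vj) //.
by rewrite addrC (even_map_mem piE yj ui).
Qed.

(** Exchanging the factors swaps the two terms in [V], and the sign squares to 1. *)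
Lemma star_supercomm i j a b : a \in GS i -> b \in GS j ->
  a ** b = ksign K i j *: (b ** a).
Proof.
move=> ai bj; rewrite (starE ai bj) (starE bj ai).
rewrite [RHS]surjective_pairing /= scalerDr scalerA (ksignC _ j i) ksignMK scale1r.
congr pair; last exact: addrC.
by move: ai bj; rewrite !mem_sum_grading => /andP[xi _] /andP[yj _];
  apply: mock_supercomm mJ _ _ _ _ xi yj.
Qed.

(** The defect [D(x, y)]; the degrees are explicit arguments because they determine the sign. *)
Definition repr_defect i j x y : 'End(V) :=
  (pi (mul x y) + (pi x \o pi y) + ksign K i j *: (pi y \o pi x))%VF.

Lemma repr_defect_eq0 i j x y : repr_defect i j x y = 0 <->
  pi (mul x y) = - (pi x \o pi y)%VF - ksign K i j *: (pi y \o pi x)%VF.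
Proof.
rewrite /repr_defect -addrA -opprD; split=> [/eqP|->]; last exact: addNr.
by rewrite addr_eq0 => /eqP.
Qed.

Definition star_jacobian i j k a b c : J * V :=
  ksign K i k *: (a ** (b ** c)) + ksign K i j *: (b ** (c ** a))
    + ksign K j k *: (c ** (a ** b)).

(** The [J]-component is the Jacobi sum of [J]. Each double product contributes three terms to the
    [V]-component, and the nine terms regroup into three defects. *)
Lemma star_jacobianE i j k a b c : a \in GS i -> b \in GS j -> c \in GS k ->
  star_jacobian i j k a b c =
    (0, ksign K i k *: repr_defect i j a.1 b.1 c.2
      + ksign K j k *: repr_defect k i c.1 a.1 b.2
      + ksign K i j *: repr_defect j k b.1 c.1 a.2).
Proof.
move=> ai bj ck; rewrite /star_jacobian.
rewrite (starE ai (star_even bj ck)) (starE bj (star_even ck ai)).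
rewrite (starE ck (star_even ai bj)) (starE bj ck) (starE ck ai) (starE ai bj).
rewrite [LHS]surjective_pairing /=; congr pair.
  move: ai bj ck; rewrite !mem_sum_grading.
  move=> /andP[xi _] /andP[yj _] /andP[zk _].
  exact: mock_jacobi mJ _ _ _ _ _ _ xi yj zk.
rewrite /repr_defect !add_lfunE !scale_lfunE !comp_lfunE !linearD !linearZ /=.
(* Signs of sums of degrees are split and written with their indices in a fixed order, so that
   repeated signs cancel. *)
rewrite !ksignDr (ksignC _ j i) (ksignC _ k i) (ksignC _ k j).
rewrite !scalerA -!mulrA !ksignMK !mulr1 !addrA.
(* Terms are sorted by the vector acted on: 9, 1, 5 for [c.2], then 6, 7, 2 for [b.2], then 3, 4, 8
   for [a.2]. *)
rewrite [LHS](ACl (9*1*5*6*7*2*3*4*8)).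
rewrite (mulrC (ksign K i k)) (mulrC (ksign K j k)).
by rewrite (mulrC (ksign K i j) (ksign K j k)).
Qed.

Lemma repr_of_star_mock_lie :
  is_mock_lie_superalgebra GS (star GJ GV mul pi) ->
  is_representation GJ mul GV pi.
Proof.
move=> mS; split=> // i j x y xi yj; apply/repr_defect_eq0.
apply: (eq_lfun_homog gV) => k w wk; rewrite zero_lfunE.
(* Zero is homogeneous of every degree, so each padded pair keeps the degree of its other entry. *)
have ai : (x, 0) \in GS i by rewrite mem_sum_grading xi mem0v.
have bj : (y, 0) \in GS j by rewrite mem_sum_grading yj mem0v.
have ck : (0, w) \in GS k by rewrite mem_sum_grading mem0v.
have := mock_jacobi mS ai bj ck.
rewrite -/(star_jacobian i j k _ _ _) (star_jacobianE ai bj ck) /=.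
(* Two defects are applied to 0 and vanish; multiplying by the remaining sign once more removes
   it. *)
rewrite !linear0 !addr0 => -[/(congr1 ( *:%R (ksign K i k)))].
by rewrite scalerA ksignMK scale1r scaler0.
Qed.

Lemma star_mock_lie_of_repr :
  is_representation GJ mul GV pi ->
  is_mock_lie_superalgebra GS (star GJ GV mul pi).
Proof.
move=> rV; split.
- exact: is_grading_sum (mock_grading mJ) gV.
- exact: star_linear_l.
- exact: star_linear_r.
- exact: star_even.
- exact: star_supercomm.
(* The Jacobi identity remains: all three defects have homogeneous arguments, so [repr_mul] makes
   them zero. *)
move=> i j k a b c ai bj ck.
have D0 l m u v : u \in GJ l -> v \in GJ m -> repr_defect l m u v = 0.
  by move=> ul vm; apply/repr_defect_eq0/(repr_mul rV).
rewrite -/(star_jacobian i j k a b c) (star_jacobianE ai bj ck).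
move: ai bj ck; rewrite !mem_sum_grading.
move=> /andP[xi _] /andP[yj _] /andP[zk _].
by rewrite !D0 // !zero_lfunE !scaler0 !addr0.
Qed.

End Star.

Unset Implicit Arguments.

Theorem proposition2p6 (K : fieldType) (charK0 : [pchar K] =i pred0)
    (J V : vectType K)
    (GJ : 'Z_2 -> {vspace J}) (GV : 'Z_2 -> {vspace V})
    (mul : J -> J -> J) (pi : {linear J -> 'End(V)}) :
  is_mock_lie_superalgebra GJ mul ->
  is_grading GV ->
  is_even_map GJ GV pi ->
  is_mock_lie_superalgebra (sum_grading GJ GV) (star GJ GV mul pi) <->
  is_representation GJ mul GV pi.
Proof.
move=> mJ gV piE; split; first exact: repr_of_star_mock_lie.
exact: star_mock_lie_of_repr.
Qed.
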